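(* Let $n, r$ be positive integers. There exist sets $A, B$ of $n$ lines each in the plane, each in general position, such that for every convex partition $C_1, \ldots, C_r$ of the plane into $r$ sets, there exists some $j \in \{1, \ldots, r \}$ such that either every subset of $A$ enclosed by $C_j$ has at most $\lceil n^{1/r} \rceil$ lines, or every subset of $B$ enclosed by $C_j$ has at most $\lceil n^{1/r} \rceil$ lines.
   Context: A convex partition of $\mathbb{R}^2$ into $r$ parts is a family of closed convex sets $C_1,\ldots,C_r\subset\mathbb{R}^2$ whose union is $\mathbb{R}^2$ and whose interiors are pairwise disjoint. For a set $L$ of lines in the plane, no two of which are parallel, $I(L)$ denotes the set of pairwise intersection points of (distinct) lines of $L$; a set $K\subset\mathbb{R}^2$ encloses $L$ if $I(L)\subset K$. A set $L$ of lines in the plane is in general position if: (i) no two lines in $L$ are parallel; (ii) no three lines in $L$ are concurrent; (iii) if three points in $I(L)$ are collinear, they belong to the same line in $L$. *)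

(* Defs.v *)
From mathcomp Require Import all_boot all_order all_algebra.
From mathcomp Require Import all_classical all_reals all_analysis.

Set Implicit Arguments.
Unset Strict Implicit.
Unset Printing Implicit Defensive.

Import Order.TTheory GRing.Theory Num.Theory.
Import numFieldNormedType.Exports.

Local Open Scope classical_set_scope.
Local Open Scope ring_scope.

(* [R^o] provides the module structure required by [convex_set]. *)
Notation plane R := (R^o * R^o)%type.

Definition is_line {R : realType} (l : set (plane R)) : Prop :=
  exists a b c : R, (a, b) != (0, 0) /\
    l = [set p | a * p.1 + b * p.2 = c].

Definition parallel {R : realType} (l m : set (plane R)) : Prop :=
  l = m \/ l `&` m = set0.

Definition collinear {R : realType} (p q s : plane R) : Prop :=
  exists l : set (plane R), [/\ is_line l, l p, l q & l s].

Definition intersections {R : realType} (L : set (set (plane R))) :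
    set (plane R) :=
  [set p | exists l m : set (plane R), [/\ L l, L m, l <> m, l p & m p]].

Definition encloses {R : realType} (K : set (plane R))
    (L : set (set (plane R))) : Prop :=
  intersections L `<=` K.

(* Both conditions on triples concern three distinct objects: for instance, any
   two points are collinear with a repetition of one of them. *)
Definition general_position {R : realType} (L : set (set (plane R))) : Prop :=
  [/\ forall l m, L l -> L m -> l <> m -> ~ parallel l m,
      forall l m k, L l -> L m -> L k -> l <> m -> l <> k -> m <> k ->
        ~ exists p, [/\ l p, m p & k p] &
      forall p q s, intersections L p -> intersections L q ->
        intersections L s -> p <> q -> p <> s -> q <> s ->
        collinear p q s -> exists l, [/\ L l, l p, l q & l s]].

(* As the definition requires only disjoint interiors, parts may be empty,
   degenerate, or repeated when their interior is empty. *)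
Definition convex_partition {R : realType} (r : nat)
    (C : 'I_r -> set (plane R)) : Prop :=
  [/\ forall j, closed (C j),
      forall j, convex_set (C j),
      \bigcup_j C j = setT &
      trivIset setT (fun j => (C j)°)].

(* Main.v *)
(** Write the indices [i < n] of the lines of [A] with [r] digits in base
    [m = ceil (n^(1/r))], and arrange that two lines of [A] meet at height about
    [k] when [k] is the first digit in which their indices differ. If all the
    intersections of a subset of [A] have the same height level [k], then digit
    [k] is injective on it, so it has at most [m] lines. Let all the
    intersections of [B] be very far away in the horizontal direction, at
    bounded height. If every part enclosed more than [m] lines of both [A] and
    [B], it would contain a point of [B] far away, and points of [A] at two
    levels, say at level at most [k] and at least [k + 1], with [k + 1 < r]. By
    the pigeonhole principle two parts have the same [k]; both then contain a
    box at height [k + 1/2] lying between [A] and [B], so their interiors meet.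
    General position is obtained by perturbing the lines one at a time, away
    from finitely many bad positions. *)
Require Import Defs.
From mathcomp Require Import all_boot all_order all_algebra.
From mathcomp Require Import all_classical all_reals all_analysis.
From mathcomp Require Import ring lra.

Set Implicit Arguments.
Unset Strict Implicit.

Import Order.TTheory GRing.Theory Num.Theory.
Import numFieldNormedType.Exports.

Local Open Scope classical_set_scope.
Local Open Scope card_scope.
Local Open Scope ring_scope.

(** * Lines in the plane *)

(** The abscissa is a function of the ordinate, so that nearly equal slopes [u] describe nearly
    vertical translates and the height of a meeting point is a quotient of differences. *)
Definition graph_line {R : realType} (u w : R) : set (plane R) :=
  [set p | p.1 = u * p.2 + w].

(** Vanishing of the determinant of [q - p] and [s - p]; for [p = q] this is the whole plane. *)
Definition joining_line {R : realType} (p q : plane R) : set (plane R) :=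
  [set s | (q.1 - p.1) * (s.2 - p.2) = (q.2 - p.2) * (s.1 - p.1) :> R].

Lemma is_line_graph_line {R : realType} (u w : R) : is_line (graph_line u w).
Proof.
exists 1, (- u), w; split; first by rewrite xpair_eqE oner_eq0.
by apply/seteqP; split=> -[x y] /=; rewrite /graph_line /= => h; lra.
Qed.

(** The vector [q - p] is orthogonal to the normal [(a, b)], hence equal to [d] times [(b, - a)]
    with [d] nonzero; cancelling [d] turns one equation into the other. *)
Lemma is_line_joining {R : realType} (l : set (plane R)) (p q : plane R) :
  is_line l -> l p -> l q -> p <> q -> l = joining_line p q.
Proof.
case: p q => [p1 p2] [q1 q2] [a [b [c [ab0 ->]]]] /= lp lq pq.
have [d [d0 e1 e2]] : exists d : R,
    [/\ d != 0, q1 - p1 = d * b & q2 - p2 = - (d * a)].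
  have h : a * (q1 - p1) = - (b * (q2 - p2)) by lra.
  have [a0|a0] := eqVneq a 0.
    have b0 : b != 0 by move: ab0; rewrite a0 xpair_eqE eqxx.
    have h2 : q2 - p2 = 0.
      by apply/(mulfI b0)/oppr_inj; rewrite -h a0; ring.
    exists ((q1 - p1) / b); split; last 2 first.
    - by rewrite mulfVK.
    - by rewrite h2 a0 mulr0 oppr0.
    rewrite mulf_neq0 ?invr_eq0 //; apply: contra_notN pq => /eqP h1.
    by congr (_, _); apply/eqP; rewrite eq_sym -subr_eq0 ?h1 ?h2.
  exists (- ((q2 - p2) / a)); split; last 2 first.
  - by apply: (mulfI a0); rewrite h; field.
  - by rewrite mulNr opprK mulfVK.
  rewrite oppr_eq0 mulf_neq0 ?invr_eq0 //; apply: contra_notN pq => /eqP h2.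
  have h1 : q1 - p1 = 0 by apply: (mulfI a0); rewrite h h2; ring.
  by congr (_, _); apply/eqP; rewrite eq_sym -subr_eq0 ?h1 ?h2.
apply/seteqP; split=> -[x y] /=; rewrite /joining_line /= e1 e2 => h.
  have : d * (a * x + b * y - c) = 0 by rewrite h subrr mulr0.
  by move=> h'; rewrite -lp in h'; lra.
by apply: (mulfI d0); rewrite -lp; lra.
Qed.

Lemma graph_line_meet {R : realType} (u u' w w' : R) :
  u <> u' -> graph_line u w `&` graph_line u' w' !=set0.
Proof.
move=> /eqP; rewrite -subr_eq0 => uu'.
exists (u * ((w' - w) / (u - u')) + w, (w' - w) / (u - u')); split=> //.
by rewrite /graph_line /=; field.
Qed.

Lemma graph_line_inj {R : realType} (u u' w w' : R) :
  graph_line u w = graph_line u' w' -> u = u'.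
Proof.
move=> h.
have h0 : graph_line u w (w, 0) by rewrite /graph_line /=; ring.
have h1 : graph_line u w (u + w, 1) by rewrite /graph_line /=; ring.
by move: h0 h1; rewrite h /graph_line /= => h0 h1; lra.
Qed.


(** * General position by successive perturbations *)

Section generic_lines.
Context {R : realType}.
Implicit Types (L : set (set (plane R))) (p q s : plane R).

Lemma finite_meet (l m : set (plane R)) : is_line l -> is_line m -> l <> m ->
  finite_set (l `&` m).
Proof.
move=> ll lm nlm; have [->|/set0P[p [lp mp]]] := eqVneq (l `&` m) set0.
  exact: finite_set0.
apply: (@sub_finite_set _ _ [set p]); last exact: finite_set1.
move=> q [lq mq] /=; apply: contrapT => qp; apply: nlm.
by rewrite (is_line_joining ll lq lp qp) (is_line_joining lm mq mp qp).
Qed.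

Lemma finite_intersections L : finite_set L -> (forall l, L l -> is_line l) ->
  finite_set (intersections L).
Proof.
move=> fL lL; apply: (@sub_finite_set _ _
  (\bigcup_(l in L) \bigcup_(m in L `&` [set m | l <> m]) (l `&` m))).
  by move=> p [l [m [Ll Lm lm lp mp]]]; exists l => //; exists m.
apply: bigcup_finite => // l Ll; apply: bigcup_finite.
  by apply: sub_finite_set fL => m [].
by move=> m [Lm lm]; apply: finite_meet => //; exact: lL.
Qed.

(* The values to be avoided are those for which the new line passes through an
   old intersection point, or through a point where a line of [L] meets a line
   joining two old intersection points. *)
Lemma general_position_add L (u : R) : finite_set L ->
  (forall l, L l -> exists u' w', u' <> u /\ l = graph_line u' w') ->
  general_position L ->
  exists2 X : set R, finite_set X &
    forall w, ~ X w -> general_position (L `|` [set graph_line u w]).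
Proof.
move=> fL oL [par conc col].
have lL l : L l -> is_line l.
  by move=> /oL[u' [w' [_ ->]]]; exact: is_line_graph_line.
have fI := finite_intersections fL lL.
(* [f s] is the only [w] for which [graph_line u w] passes through [s]. *)
pose f (s : plane R) : R := s.1 - u * s.2.
pose Y := \bigcup_(p in intersections L)
  \bigcup_(q in intersections L `&`
      [set q | p <> q /\ is_line (joining_line p q)])
  \bigcup_(l in L `&` [set l | l <> joining_line p q]) (l `&` joining_line p q).
have fY : finite_set Y.
  apply: bigcup_finite => // p Ip; apply: bigcup_finite.
    by apply: sub_finite_set fI => q [].
  move=> q [Iq [pq lpq]]; apply: bigcup_finite.
    by apply: sub_finite_set fL => l [].
  by move=> l [Ll nl]; apply: finite_meet => //; exact: lL.
exists (f @` (intersections L `|` Y)).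
  by apply: finite_image; rewrite finite_setU.
move=> w Xw; set l0 := graph_line u w.
have fE s : l0 s -> f s = w by rewrite /l0 /graph_line /f /= => ->; ring.
have l0I s : intersections L s -> ~ l0 s.
  by move=> Is /fE fs; apply: Xw; exists s => //; left.
have l0Y s : Y s -> ~ l0 s.
  by move=> Is /fE fs; apply: Xw; exists s => //; right.
have l0l : is_line l0 by exact: is_line_graph_line.
have L'l l : (L `|` [set l0]) l -> is_line l by case=> [/lL|->].
have I'P s : intersections (L `|` [set l0]) s ->
    intersections L s \/ (l0 s /\ exists2 l, L l & l s).
  move=> [l [m [[Ll|->] [Lm|->] lm ls ms]]].
  - by left; exists l, m.
  - by right; split => //; exists l.
  - by right; split => //; exists m.
  - by case: lm.
split.
- have meet l : L l -> l `&` l0 !=set0.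
    by move=> /oL[u' [w' [uu' ->]]]; exact: graph_line_meet.
  move=> l m [Ll|->] [Lm|->] lm [//|lm0].
  + by apply: (par l m) => //; right.
  + by have /set0P := meet _ Ll; rewrite lm0 eqxx.
  + by have /set0P := meet _ Lm; rewrite setIC lm0 eqxx.
  + exact: lm.
- move=> l m k [Ll|->] [Lm|->] [Lk|->] lm lk mk [p [lp mp kp]] //.
  + by apply: (conc l m k) => //; exists p.
  + by apply: (l0I p) => //; exists l, m.
  + by apply: (l0I p) => //; exists l, k.
  + by apply: (l0I p) => //; exists m, k.
(* Two of the points lie on the new line, which is then the line joining them and contains the
   third. *)
have two_new p q s : p <> q -> l0 p -> l0 q -> collinear p q s ->
    exists l, [/\ (L `|` [set l0]) l, l p, l q & l s].
  move=> pq p0 q0 [l [ll lp lq ls]]; exists l0; split => //; first by right.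
  by rewrite (is_line_joining l0l p0 q0 pq) -(is_line_joining ll lp lq pq).
(* Here [s] lies on an old line and on the line joining two old intersection points. Either these
   lines coincide, or [s] is in [Y], which the new line avoids. *)
have one_new p q s : p <> q -> intersections L p -> intersections L q ->
    l0 s -> (exists2 l, L l & l s) -> collinear p q s ->
    exists l, [/\ (L `|` [set l0]) l, l p, l q & l s].
  move=> pq Ip Iq s0 [l Ll sl] [m [lm mp mq ms]].
  have mE := is_line_joining lm mp mq pq.
  have [ml|nml] := pselect (m = l).
    by exists l; split; [left | rewrite -ml | rewrite -ml |].
  exfalso; apply: (l0Y s) => //; exists p => //; exists q.
    by split=> //=; split=> //; rewrite -mE.
  by exists l; rewrite -mE //=; split=> //= /esym.
have perm3 p q s : collinear p q s -> collinear p s q /\ collinear q s p.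
  by move=> [l [ll lp lq ls]]; split; exists l.
move=> p q s /I'P[Ip|[p0 Lp]] /I'P[Iq|[q0 Lq]] /I'P[Is|[s0 Ls]] pq ps qs cpqs.
- have [l [Ll lp lq ls]] := col p q s Ip Iq Is pq ps qs cpqs.
  by exists l; split=> //; left.
- exact: one_new.
- have [cpsq _] := perm3 _ _ _ cpqs.
  by have [l [? ? ? ?]] := one_new _ _ _ ps Ip Is q0 Lq cpsq; exists l.
- have [_ cqsp] := perm3 _ _ _ cpqs.
  by have [l [? ? ? ?]] := two_new q s p qs q0 s0 cqsp; exists l.
- have [_ cqsp] := perm3 _ _ _ cpqs.
  by have [l [? ? ? ?]] := one_new q s p qs Iq Is p0 Lp cqsp; exists l.
- have [cpsq _] := perm3 _ _ _ cpqs.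
  by have [l [? ? ? ?]] := two_new p s q ps p0 s0 cpsq; exists l.
- exact: two_new.
- exact: two_new.
Qed.

Lemma finite_avoid (X : set R) (v e : R) : finite_set X -> 0 < e ->
  exists2 w, `|w - v| < e & ~ X w.
Proof.
move=> fX e0; apply: contrapT => noX.
(* Infinitely many distinct candidates; starting the denominators at 2 keeps them at distance
   strictly less than [e] from [v]. *)
pose f k : R := v + e / k.+2%:R.
have : finite_set (f @^-1` X).
  apply: finite_preimage => // i j _ _ /addrI /(mulfI (lt0r_neq0 e0)).
  by move=> /invr_inj /eqP; rewrite eqr_nat => /eqP [].
have -> : f @^-1` X = setT; last exact: infinite_nat.
apply/seteqP; split=> // k _ /=; apply: contrapT => fk; apply: noX.
exists (f k) => //; rewrite /f addrAC subrr add0r ger0_norm.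
  by rewrite ltr_pdivrMr ?ltr0n // ltr_pMr // ltr1n.
by rewrite divr_ge0 ?ler0n // ltW.
Qed.

(** Induction on [n]: the earlier lines stay in place and only the [w] of the last one is adjusted.
    The slopes are kept, so they remain distinct. *)
Lemma exists_general_position (u v : nat -> R) (n : nat) (e : R) : 0 < e ->
  set_inj `I_n u ->
  exists2 w : nat -> R, (forall i, `|w i - v i| < e) &
    general_position [set graph_line (u i) (w i) | i in `I_n].
Proof.
move=> e0; elim: n => [_|n IH uinj].
  exists v; first by move=> i; rewrite subrr normr0.
  rewrite II0 image_set0; split=> [l m|l m k|p q s [l [m []]]]; by [].
have [|w wv gp] := IH.
  by move=> i j; rewrite !inE /= => hi hj; apply: uinj; rewrite inE /= ltnW.
have [|l [i /= ni <-]|X fX hX] := general_position_add (u := u n) _ _ gp.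
- exact/finite_image/finite_II.
- exists (u i), (w i); split=> // uin.
  have iE : i = n by apply: uinj => //; rewrite inE //= ltnW.
  by rewrite iE ltnn in ni.
have [wn wnv Xwn] := finite_avoid (v n) fX e0.
exists (fun i => if i == n then wn else w i).
  by move=> i; case: eqP => // ->.
have -> : [set graph_line (u i) (if i == n then wn else w i) | i in `I_n.+1]
  = [set graph_line (u i) (w i) | i in `I_n] `|` [set graph_line (u n) wn].
  rewrite IIS image_setU image_set1 eqxx; congr (_ `|` _).
  by apply: eq_imagel => i /= ni; rewrite (ltn_eqF ni).
exact: hX.
Qed.

End generic_lines.

(** * Boxes inside convex sets with a far away point *)

Section convex_triangles.
Context {R : realType}.
Implicit Types (C : set (plane R)) (p q b : plane R).

Lemma convex_set_segment C p q (t : R) : convex_set C -> C p -> C q ->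
  0 <= t -> t <= 1 -> C (p.1 + t * (q.1 - p.1), p.2 + t * (q.2 - p.2)).
Proof.
move=> cC Cp Cq t0 t1.
have t01 : Itv.spec (@Itv.num_sem R) (Itv.Real `[0%Z, 1%Z]) t.
  by apply/andP; split; [rewrite num_real | rewrite /= in_itv /= t0 t1].
have := cC q p (Itv.Def t01); rewrite !inE => /(_ Cq Cp).
congr (C _).
transitivity ((t * q.1 + (1 - t) * p.1, t * q.2 + (1 - t) * p.2) : plane R).
  by [].
by congr (_, _); ring.
Qed.

(** The segment from [p] to [b] reaches abscissa [x] at a parameter [t] of at most [1 / (16 H)],
    since [x - p.1 <= 2 W + 1]. As the heights of its ends differ by at most [2 H], it has drifted
    by at most [1 / 8]. *)
Lemma convex_set_far C p b (W H x : R) : convex_set C -> C p -> C b ->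
  1 <= H -> `|p.1| <= W -> `|p.2| <= H -> `|b.2| <= H ->
  W + 16%:R * H * (2%:R * W + 1) <= b.1 -> W < x -> x < W + 1 ->
  exists2 y, C (x, y) & `|y - p.2| <= 1 / 8%:R.
Proof.
case: p b => [p1 p2] [b1 b2] /= cC Cp Cb H1.
have H0 : 0 < H by exact: lt_le_trans H1.
rewrite !ler_norml => /andP[pW Wp] /andP[pH Hp] /andP[bH Hb] Xb Wx xW.
have W0 : 0 <= W by lra.
have HW : 0 <= H * W by rewrite mulr_ge0 // ltW.
have bp : 0 < b1 - p1 by lra.
pose t := (x - p1) / (b1 - p1).
have t0 : 0 <= t by rewrite divr_ge0 //; lra.
have tx : t * (b1 - p1) = x - p1 by rewrite /t divfK // lt0r_neq0.
have tH : t * (16%:R * H) <= 1.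
  rewrite -(ler_pM2r bp) mulrAC tx mul1r.
  apply: (@le_trans _ _ ((2%:R * W + 1) * (16%:R * H))); last by lra.
  by rewrite ler_wpM2r //; lra.
have t1 : t <= 1 by rewrite ler_pdivrMr // mul1r; nra.
have := convex_set_segment cC Cp Cb t0 t1; rewrite /= tx subrKC => Ct.
exists (p2 + t * (b2 - p2)) => //.
rewrite addrAC subrr add0r ler_norml.
have h1 : t * (b2 - p2) <= t * (2%:R * H) by rewrite ler_wpM2l //; lra.
have h2 : t * - (2%:R * H) <= t * (b2 - p2) by rewrite ler_wpM2l //; lra.
by apply/andP; split; lra.
Qed.

(* Seen from a far away point [b], two points on both sides of the horizontal
   line of height [h] keep apart up to the abscissa [W + 1]. *)
Lemma convex_set_box C p q b (W H h : R) : convex_set C -> C p -> C q -> C b ->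
  1 <= H -> `|p.1| <= W -> `|q.1| <= W -> `|p.2| <= H -> `|q.2| <= H ->
  `|b.2| <= H -> W + 16%:R * H * (2%:R * W + 1) <= b.1 ->
  p.2 <= h - 1 / 4%:R -> h + 1 / 4%:R <= q.2 ->
  [set s | W < s.1 < W + 1 /\ `|s.2 - h| < 1 / 8%:R] `<=` C.
Proof.
move=> cC Cp Cq Cb H1 pW qW pH qH bH Xb ph hq [x y] /= [/andP[Wx xW]].
have [y1 C1] := convex_set_far cC Cp Cb H1 pW pH bH Xb Wx xW.
have [y2 C2] := convex_set_far cC Cq Cb H1 qW qH bH Xb Wx xW.
rewrite !ler_norml ltr_norml => /andP[h1 h2] /andP[h3 h4] /andP[h5 h6].
(* A drift of at most [1 / 8] leaves [y1 <= h - 1 / 8] and [h + 1 / 8 <= y2], so the vertical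
   segment between the two points contains [(x, y)]. *)
have y12 : 0 < y2 - y1 by lra.
pose t := (y - y1) / (y2 - y1).
have t0 : 0 <= t by rewrite divr_ge0 //; lra.
have t1 : t <= 1 by rewrite ler_pdivrMr // mul1r; lra.
have := convex_set_segment cC C1 C2 t0 t1.
by rewrite /= subrr mulr0 addr0 /t divfK ?lt0r_neq0 // subrKC.
Qed.

Lemma box_interior C (W h : R) :
  [set s | W < s.1 < W + 1 /\ `|s.2 - h| < 1 / 8%:R] `<=` C ->
  C° (W + 1 / 2%:R, h).
Proof.
move=> boxC; rewrite /interior.
exists (ball (W + 1 / 2%:R) (1 / 2%:R), ball h (1 / 8%:R)).
  by split; apply: nbhsx_ballx; lra.
move=> [x y] [/=]; rewrite -!ball_normE /= ltr_distlC distrC => /andP[h1 h2] h3.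
by apply: boxC; split => //=; lra.
Qed.

End convex_triangles.

(** * Digits in base [m], the least significant one having index [0] *)

Definition digit (m k i : nat) : nat := ((i %/ m ^ k) %% m)%N.

Definition first_differing (m k i j : nat) : Prop :=
  digit m k i <> digit m k j /\
  forall k', (k' < k)%N -> digit m k' i = digit m k' j.

Lemma digit_inj (m r i j : nat) : (i < m ^ r)%N -> (j < m ^ r)%N ->
  (forall k, (k < r)%N -> digit m k i = digit m k j) -> i = j.
Proof.
elim: r i j => [|r IH] i j.
  by rewrite expn0 !ltnS !leqn0 => /eqP -> /eqP ->.
rewrite expnS => hi hj dij.
have m0 : (0 < m)%N by case: m hi {IH hj dij}.
rewrite (divn_eq i m) (divn_eq j m); congr (_ * _ + _)%N.
  apply: IH => [||k kr]; rewrite ?ltn_divLR // 1?mulnC //.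
  by have := dij k.+1 kr; rewrite /digit expnS !divnMA.
by have := dij 0%N (ltn0Sn _); rewrite /digit expn0 !divn1.
Qed.

Lemma exists_first_differing (m r i j : nat) :
  (i < m ^ r)%N -> (j < m ^ r)%N -> i <> j ->
  exists2 k, (k < r)%N & first_differing m k i j.
Proof.
move=> hi hj ij.
have ex : exists k, digit m k i != digit m k j.
  apply: contrapT => nex; apply/ij/(digit_inj hi hj) => k _.
  by apply/eqP; apply: contrapT => nk; apply: nex; exists k; apply/negP.
case: (ex_minnP ex) => k dk mink.
exists k; last first.
  split; first exact/eqP.
  move=> k' kk'; apply/eqP; apply: contraTT kk' => /mink.
  by rewrite -leqNgt.
rewrite ltnNge; apply/negP => rk; apply/ij/(digit_inj hi hj) => k' k'r.
apply/eqP; apply: contraTT (leq_trans k'r rk) => /mink.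
by rewrite -leqNgt.
Qed.

Lemma card_le_inj {T : Type} (A : set T) (f : T -> nat) (m : nat) :
  (forall x, A x -> (f x < m)%N) ->
  (forall x y, A x -> A y -> f x = f y -> x = y) -> A #<= `I_m.
Proof.
move=> fm finj; apply: (@card_le_trans _ _ _ (f @` A)).
  have : f @` A #= A.
    by apply: inj_card_eq => x y; rewrite !inE => *; exact: finj.
  by rewrite card_eq_le => /andP[].
by apply: subset_card_le => _ [x Ax <-]; exact: fm.
Qed.

(** A digit takes only [m] values, so for each index [k] two elements of [S] share digit [k], and
    they first differ at an index other than [k]. *)
Lemma exists_two_levels (m r n : nat) (S : set nat) : (0 < m)%N ->
  (n <= m ^ r)%N -> S `<=` `I_n -> ~ (S #<= `I_m) ->
  exists a b, [/\ (a < b)%N, (b < r)%N,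
    exists i j, [/\ S i, S j & first_differing m a i j] &
    exists i j, [/\ S i, S j & first_differing m b i j]].
Proof.
move=> m0 nr Sn Sm.
have same k : exists i j, [/\ S i, S j, i <> j & digit m k i = digit m k j].
  apply: contrapT => nex; apply: Sm; apply: (@card_le_inj _ _ (digit m k)).
    by move=> i _; rewrite /digit ltn_mod.
  move=> i j Si Sj dij; apply: contrapT => ij; apply: nex.
  by exists i, j.
(* Elements sharing the digit of index [k] part at an index other than [k]. *)
have part k : exists a i j, [/\ (a < r)%N, a <> k, S i, S j &
    first_differing m a i j].
  have [i [j [Si Sj ij dij]]] := same k.
  have [||a ar fa] := @exists_first_differing m r i j _ _ ij.
  - exact: leq_trans (Sn _ Si) nr.
  - exact: leq_trans (Sn _ Sj) nr.
  by exists a, i, j; split=> // ak; move: fa => []; rewrite ak.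
(* The index [0] is an arbitrary start; avoiding [a] then gives a second level. *)
have [a [i [j [ar _ Si Sj fa]]]] := part 0%N.
have [b [i' [j' [br /eqP ba Si' Sj' fb]]]] := part a.
move: ba; rewrite neq_ltn => /orP[ba|ab].
  by exists b, a; split=> //; [exists i', j' | exists i, j].
by exists a, b; split=> //; [exists i, j | exists i', j'].
Qed.

(** * Construction of the two families of lines *)

Section layered_lines.
Context {R : realType}.

Lemma ler_sum_tail (F : nat -> R) (r a : nat) (M e : R) : 0 < e -> e <= 1 ->
  0 <= M -> (forall k, (k <= a)%N -> F k = 0) ->
  (forall k, (k < r)%N -> `|F k| <= M) ->
  `|\sum_(k < r) F k * e ^+ k| <= r%:R * M * e ^+ a.+1.
Proof.
move=> e0 e1 M0 F0 FM; apply: le_trans (ler_norm_sum _ _ _) _.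
rewrite -mulrA mulr_natl -[X in _ *+ X]card_ord -sumr_const.
apply: ler_sum => k _; rewrite normrM.
rewrite [`|e ^+ _|]ger0_norm ?exprn_ge0 ?(ltW e0) //.
have [ka|ak] := leqP k a.
  by rewrite F0 // normr0 mul0r mulr_ge0 // exprn_ge0 // ltW.
apply: ler_pM => //; first by rewrite exprn_ge0 // ltW.
  exact: FM.
by apply: ler_wiXn2l => //; exact: ltW.
Qed.

(** In the first difference the factor [k - a] removes the term of index [a]; in the second bound
    that term dominates. All that remains has order [e ^+ a.+1]. *)
Lemma leading_digit_bounds (D : nat -> R) (r a : nat) (M e : R) :
  (a < r)%N -> 0 < e -> e <= 1 -> 0 <= M -> 1 <= `|D a| ->
  (forall k, (k < a)%N -> D k = 0) -> (forall k, (k < r)%N -> `|D k| <= M) ->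
  `|\sum_(k < r) k%:R * D k * e ^+ k - a%:R * \sum_(k < r) D k * e ^+ k|
    <= r%:R * (r%:R * M) * e ^+ a.+1 /\
  e ^+ a - r%:R * M * e ^+ a.+1 <= `|\sum_(k < r) D k * e ^+ k|.
Proof.
move=> ar e0 e1 M0 Da D0 DM; split.
  rewrite mulr_sumr -sumrB.
  under eq_bigr => k _ do rewrite mulrA -mulrBl -mulrBl.
  apply: (@ler_sum_tail (fun k => (k%:R - a%:R) * D k)) => //.
  - by rewrite mulr_ge0.
  - move=> k; rewrite leq_eqVlt => /orP[/eqP ->|ka].
      by rewrite subrr mul0r.
    by rewrite D0 // mulr0.
  - move=> k kr; rewrite normrM; apply: ler_pM => //; last exact: DM.
    have ler0 (x y : R) : 0 <= x -> 0 <= y -> x <= r%:R -> y <= r%:R ->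
        `|x - y| <= r%:R by move=> *; rewrite ler_norml; apply/andP; split; lra.
    by apply: ler0; rewrite ?ler0n // ler_nat ltnW.
pose F k := if k == a then 0 else D k.
have FE : \sum_(k < r) D k * e ^+ k
    = D a * e ^+ a + \sum_(k < r) F k * e ^+ k.
  rewrite (bigD1 (Ordinal ar)) //= [in RHS](bigD1 (Ordinal ar)) //=.
  rewrite /F eqxx mul0r add0r; congr (_ + _); apply: eq_bigr => k ka.
  by rewrite (negbTE (_ : k != a :> nat)).
have FM : `|\sum_(k < r) F k * e ^+ k| <= r%:R * M * e ^+ a.+1.
  apply: ler_sum_tail => //.
    by move=> k; rewrite /F leq_eqVlt => /orP[->//|ka]; rewrite D0 // if_same.
  by move=> k kr; rewrite /F; case: eqP => _; [rewrite normr0 | exact: DM].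
rewrite FE.
have Dea : e ^+ a <= `|D a * e ^+ a|.
  have ea : 0 <= e ^+ a by rewrite exprn_ge0 // ltW.
  by rewrite normrM (ger0_norm ea) ler_peMl.
have := lerB_normD (D a * e ^+ a) (\sum_(k < r) F k * e ^+ k).
by lra.
Qed.

(* Giving the line [i] the slope [\sum_k d_k e^k] and the abscissa
   [- \sum_k k * d_k e^k] at the origin, where the [d_k] are the digits of [i],
   two lines meet at height about [a], the least index at which their digits
   differ, because the terms of index [a] dominate when [e] is small. *)
Lemma exists_layered_lines (n m r : nat) : (0 < m)%N -> (0 < r)%N ->
  (n <= m ^ r)%N ->
  exists u w : nat -> R, exists W : R, [/\ set_inj `I_n u,
    general_position [set graph_line (u i) (w i) | i in `I_n] &
    forall (i j a : nat) (p : plane R), (i < n)%N -> (j < n)%N -> (a < r)%N ->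
      first_differing m a i j ->
      graph_line (u i) (w i) p -> graph_line (u j) (w j) p ->
      `|p.1| <= W /\ `|p.2 - a%:R| <= 1 / 4%:R].
Proof.
move=> m0 r0 nr.
have m1 : 1 <= m%:R :> R by rewrite ler1n.
have r1 : 1 <= r%:R :> R by rewrite ler1n.
(* Chosen so that both error terms above are at most [e ^+ a / 16]. *)
pose e : R := (16%:R * (r%:R * (r%:R * m%:R)))^-1.
have rm1 : 1 <= r%:R * m%:R :> R by rewrite mulr_ege1.
have rrm1 : 1 <= r%:R * (r%:R * m%:R) :> R by rewrite mulr_ege1.
have rrm : r%:R * m%:R <= r%:R * (r%:R * m%:R) :> R by rewrite ler_peMl //; lra.
have e0 : 0 < e by rewrite invr_gt0; lra.
have ee : r%:R * (r%:R * m%:R) * e = 1 / 16%:R.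
  rewrite /e; field; rewrite !pnatr_eq0 -!lt0n; exact/andP.
have e1 : e <= 1.
  rewrite -[e]mul1r; apply: (@le_trans _ _ (r%:R * (r%:R * m%:R) * e)).
    by rewrite ler_pM2r.
  by rewrite ee; lra.
pose d k i : R := (digit m k i)%:R.
have dm k i : `|d k i| <= m%:R.
  by rewrite /d normr_nat ler_nat ltnW // /digit ltn_mod.
pose u i := \sum_(k < r) d k i * e ^+ k.
pose v i := - \sum_(k < r) k%:R * d k i * e ^+ k.
have key i j a : (a < r)%N -> first_differing m a i j ->
    `|v i - v j + a%:R * (u i - u j)| <= e ^+ a / 16%:R /\
    e ^+ a / 2%:R <= `|u i - u j|.
  move=> ar [da dk].
  have := @leading_digit_bounds (fun k => d k i - d k j) r a m%:R e ar e0 e1.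
  case.
  - by [].
  - rewrite /d; case: (ltngtP (digit m a i) (digit m a j)) => // h.
      by rewrite distrC -natrB ?(ltnW h) // normr_nat ler1n subn_gt0.
    by rewrite -natrB ?(ltnW h) // normr_nat ler1n subn_gt0.
  - by move=> k ka; rewrite /d dk // subrr.
  - move=> k kr; have d0 l : 0 <= d k l by rewrite ler0n.
    have := dm k i; have := dm k j; have := d0 i; have := d0 j.
    rewrite (ger0_norm (d0 i)) (ger0_norm (d0 j)) ler_norml => *.
    by apply/andP; split; lra.
  have -> : \sum_(k < r) (d k i - d k j) * e ^+ k = u i - u j.
    by rewrite /u -sumrB; apply: eq_bigr => k _; rewrite mulrBl.
  have -> : \sum_(k < r) k%:R * (d k i - d k j) * e ^+ k = - (v i - v j).
    by rewrite /v opprD !opprK -sumrB; apply: eq_bigr => k _; ring.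
  have ea : 0 < e ^+ a by rewrite exprn_gt0.
  have -> : r%:R * (r%:R * m%:R) * e ^+ a.+1 = e ^+ a / 16%:R.
    by rewrite exprSr mulrCA ee mul1r.
  have h : r%:R * m%:R * e ^+ a.+1 <= e ^+ a / 16%:R.
    by rewrite -[_^-1]mul1r -ee exprSr mulrCA ler_pM2l // ler_pM2r.
  rewrite -opprD normrN => -[h1 h2]; split=> //.
  by lra.
have uinj : set_inj `I_n u.
  move=> i j; rewrite !inE /= => hi hj uij; apply: contrapT => ij.
  have [a ar fa] :=
      exists_first_differing (leq_trans hi nr) (leq_trans hj nr) ij.
  have [_] := key i j a ar fa; rewrite uij subrr normr0.
  by have : 0 < e ^+ a by [rewrite exprn_gt0]; lra.
(* Two perturbations add at most [e ^+ a / 32] to the error [e ^+ a / 16]; divided by a slope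
   difference of at least [e ^+ a / 2], this moves the height by less than [1 / 4]. *)
have t0 : 0 < e ^+ r / 64%:R by rewrite divr_gt0 ?exprn_gt0.
have [w wv gp] := exists_general_position v t0 uinj.
(* This bounds [u i * y + w i], using the bounds [ur], [yr] and [wi1] below. *)
exists u, w, (r%:R * m%:R * (r%:R + 1) + r%:R * (r%:R * m%:R) + 1).
split=> // i j a [x y] hi hj ar fa; rewrite /graph_line /= => pi pj.
have [V U] := key i j a ar fa.
have ea : 0 < e ^+ a by rewrite exprn_gt0.
have era : e ^+ r <= e ^+ a by apply: ler_wiXn2l; rewrite ?(ltW e0) // ltnW.
have U0 : 0 < `|u i - u j| by lra.
have ya : `|y - a%:R| <= 1 / 4%:R.
  rewrite -(ler_pM2l U0) -normrM.
  have -> : (u i - u j) * (y - a%:R) =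
    - (v i - v j + a%:R * (u i - u j)) - ((w i - v i) - (w j - v j)) by lra.
  have := wv i; have := wv j; move: V.
  rewrite !ltr_norml !ler_norml => /andP[V1 V2] /andP[w1 w2] /andP[w3 w4].
  by apply/andP; split; lra.
split=> //.
have ur : `|u i| <= r%:R * m%:R.
  apply: le_trans (ler_norm_sum _ _ _) _.
  rewrite mulr_natl -[X in _ *+ X]card_ord -sumr_const; apply: ler_sum => k _.
  have ek : 0 <= e ^+ k by rewrite exprn_ge0 // ltW.
  rewrite normrM (ger0_norm ek) -[leRHS]mulr1; apply: ler_pM => //.
  by rewrite exprn_ile1 // ltW.
have vr : `|v i| <= r%:R * (r%:R * m%:R).
  rewrite normrN; apply: le_trans (ler_norm_sum _ _ _) _.
  rewrite mulr_natl -[X in _ *+ X]card_ord -sumr_const; apply: ler_sum => k _.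
  have ek : 0 <= e ^+ k by rewrite exprn_ge0 // ltW.
  rewrite !normrM (ger0_norm ek) -[leRHS]mulr1; apply: ler_pM => //.
    by rewrite normr_nat; apply: ler_pM => //; rewrite ler_nat ltnW.
  by rewrite exprn_ile1 // ltW.
have wi1 : `|w i| <= r%:R * (r%:R * m%:R) + 1.
  have er1 : e ^+ r <= 1 by rewrite exprn_ile1 // ltW.
  have := wv i; move: vr; rewrite ltr_norml !ler_norml => /andP[? ?] /andP[? ?].
  by apply/andP; split; lra.
have yr : `|y| <= r%:R + 1.
  have ar' : a%:R <= r%:R :> R by rewrite ler_nat ltnW.
  have a0 : 0 <= a%:R :> R by rewrite ler0n.
  move: ya; rewrite !ler_norml => /andP[? ?]; apply/andP; split; lra.
rewrite pi; apply: le_trans (ler_normD _ _) _; rewrite -addrA lerD //.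
by rewrite normrM ler_pM.
Qed.

(** With slopes [i] and all [w i] within [1 / 2] of [X + n + 1], slopes differ by at least 1 and the
    [w i] by at most 1. Meeting points thus have height at most 1 in absolute value, and [u i * y]
    shifts the abscissa by at most [n]. *)
Lemma exists_far_lines (n : nat) (X : R) :
  exists u w : nat -> R, [/\ set_inj `I_n u,
    general_position [set graph_line (u i) (w i) | i in `I_n] &
    forall (i j : nat) (p : plane R), (i < n)%N -> (j < n)%N -> i <> j ->
      graph_line (u i) (w i) p -> graph_line (u j) (w j) p ->
      X <= p.1 /\ `|p.2| <= 1].
Proof.
pose u (i : nat) : R := i%:R.
have uinj : set_inj `I_n u.
  by move=> i j _ _ /eqP; rewrite /u eqr_nat => /eqP.
have t0 : 0 < 1 / 2%:R :> R by lra.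
have [w wv gp] := exists_general_position (fun=> X + n%:R + 1) t0 uinj.
exists u, w; split=> // i j [x y] hi hj ij; rewrite /graph_line /= => pi pj.
have U1 : 1 <= `|u i - u j|.
  rewrite /u; case: (ltngtP i j) => // h; first rewrite distrC.
    by rewrite -natrB ?(ltnW h) // normr_nat ler1n subn_gt0.
  by rewrite -natrB ?(ltnW h) // normr_nat ler1n subn_gt0.
have y1 : `|y| <= 1.
  apply: le_trans (_ : `|u i - u j| * `|y| <= 1); first by rewrite ler_peMl.
  rewrite -normrM; have -> : (u i - u j) * y = w j - w i by lra.
  have := wv i; have := wv j.
  rewrite !ltr_norml !ler_norml => /andP[w1 w2] /andP[w3 w4].
  by apply/andP; split; lra.
split=> //.
have uy : `|u i * y| <= n%:R.
  by rewrite normrM -[leRHS]mulr1 ler_pM // normr_nat ler_nat ltnW.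
have := wv i; move: uy; rewrite ltr_norml ler_norml => /andP[? ?] /andP[? ?].
by lra.
Qed.

End layered_lines.

(** * Cardinality and enclosure for families of lines *)

Section graph_line_families.
Context {R : realType}.

Lemma card_graph_lines (u w : nat -> R) (n : nat) : set_inj `I_n u ->
  [set graph_line (u i) (w i) | i in `I_n] #= `I_n.
Proof.
move=> uinj; apply: inj_card_eq => i j hi hj /graph_line_inj.
exact: uinj.
Qed.

Lemma is_line_graph_lines (u w : nat -> R) (n : nat) (l : set (plane R)) :
  [set graph_line (u i) (w i) | i in `I_n] l -> is_line l.
Proof. by move=> [i _ <-]; exact: is_line_graph_line. Qed.

Lemma encloses_graph_lines (u w : nat -> R) (n : nat) (K : set (plane R))
    (L : set (set (plane R))) (i j : nat) :
  set_inj `I_n u -> encloses K L -> (i < n)%N -> (j < n)%N -> i <> j ->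
  L (graph_line (u i) (w i)) -> L (graph_line (u j) (w j)) ->
  exists p, [/\ K p, graph_line (u i) (w i) p & graph_line (u j) (w j) p].
Proof.
move=> uinj KL hi hj ij Li Lj.
have uij : u i <> u j by move=> uij; apply/ij/uinj; rewrite ?inE.
have [p [pi pj]] := graph_line_meet (w i) (w j) uij.
exists p; split=> //; apply: KL.
exists (graph_line (u i) (w i)), (graph_line (u j) (w j)).
by split=> // /graph_line_inj.
Qed.

Lemma le_expn_ceil_root (n r : nat) : (0 < r)%N ->
  (n <= `|Num.ceil ((n%:R : R) `^ (r%:R)^-1)| ^ r)%N.
Proof.
move=> r0; set x := _ `^ _.
have x0 : 0 <= x by exact: powR_ge0.
rewrite -(ler_nat R) natrX natr_absz ger0_norm ?ceil_ge0 ?(lt_le_trans _ x0) //.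
have -> : n%:R = x ^+ r.
  rewrite -powR_mulrn // /x -powRrM mulVf ?pnatr_eq0 -?lt0n //.
  by rewrite powRr1.
by rewrite lerXn2r ?nnegrE // ?(le_trans x0) // ?ceil_ge.
Qed.

End graph_line_families.

(** * The pigeonhole argument on the parts *)

Unset Implicit Arguments.

Theorem theorem1p4 (R : realType) (n r : nat) (hn : (0 < n)%N) (hr : (0 < r)%N) :
  exists A B : set (set (plane R)),
    [/\ forall l, A l -> is_line l, A #= `I_n & general_position A] /\
    [/\ forall l, B l -> is_line l, B #= `I_n & general_position B] /\
    forall C : 'I_r -> set (plane R), convex_partition C ->
      exists j : 'I_r,
        (forall L : set (set (plane R)), L `<=` A -> encloses (C j) L ->
           L #<= `I_(`|Num.ceil ((n%:R : R) `^ (r%:R)^-1)|%N)) \/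
        (forall L : set (set (plane R)), L `<=` B -> encloses (C j) L ->
           L #<= `I_(`|Num.ceil ((n%:R : R) `^ (r%:R)^-1)|%N)).
Proof.
have nr := le_expn_ceil_root (R := R) n hr.
move: nr; set m := `|Num.ceil _|%N => nr.
have m0 : (0 < m)%N.
  by rewrite lt0n; apply/eqP => mE; move: nr; rewrite mE exp0n // leqNgt hn.
have [u [w [W [uinj gpA levelA]]]] := exists_layered_lines (R := R) m0 hr nr.
(* Bounds the heights of the intersection points of both families. *)
pose H : R := r%:R + 1.
have [u' [w' [u'inj gpB farB]]] :=
  exists_far_lines n (W + 16%:R * H * (2%:R * W + 1)).
exists [set graph_line (u i) (w i) | i in `I_n],
  [set graph_line (u' i) (w' i) | i in `I_n].
split.
  by split=> // [l|]; [exact: is_line_graph_lines | exact: card_graph_lines].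
split.
  by split=> // [l|]; [exact: is_line_graph_lines | exact: card_graph_lines].
move=> C [_ cC _ tC]; apply: contrapT => noj.
(* The box depends on [j] only through [a], and [a] is less than [r.-1] because a higher level [a']
   below [r] occurs as well. *)
have box j : exists2 a : nat, (a < r.-1)%N &
    [set s | W < s.1 < W + 1 /\ `|s.2 - (a%:R + 1 / 2%:R)| < 1 / 8%:R] `<=` C j.
  have [L [LA CL Lm]] : exists L,
      [/\ L `<=` [set graph_line (u i) (w i) | i in `I_n],
      encloses (C j) L & ~ (L #<= `I_m)].
    apply: contrapT => noL; apply: noj; exists j; left => L LA CL.
    by apply: contrapT => Lm; apply: noL; exists L.
  have [M [MB CM Mm]] : exists M,
      [/\ M `<=` [set graph_line (u' i) (w' i) | i in `I_n],
      encloses (C j) M & ~ (M #<= `I_m)].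
    apply: contrapT => noM; apply: noj; exists j; right => M MB CM.
    by apply: contrapT => Mm; apply: noM; exists M.
  have [b [Cb bX bH]] : exists b : plane R, [/\ C j b,
      W + 16%:R * H * (2%:R * W + 1) <= b.1 & `|b.2| <= 1].
    (* Otherwise [M] has at most one line, hence at most [m] since [m] is positive. *)
    have [l [k [Ml Mk lk]]] : exists l k, [/\ M l, M k & l <> k].
      apply: contrapT => nolk; apply: Mm.
      apply: (@card_le_inj _ _ (fun=> 0%N)) => // l k Ml Mk _.
      by apply: contrapT => lk; apply: nolk; exists l, k.
    have [i /= hi iE] := MB _ Ml; have [i' /= hi' i'E] := MB _ Mk.
    rewrite -iE -i'E in Ml Mk lk.
    have ii' : i <> i' by move=> ii'; apply: lk; rewrite ii'.
    have [b [Cb bi bi']] := encloses_graph_lines u'inj CM hi hi' ii' Ml Mk.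
    by have [? ?] := farB _ _ _ hi hi' ii' bi bi'; exists b.
  pose S := [set i | (i < n)%N /\ L (graph_line (u i) (w i))].
  have Sm : ~ (S #<= `I_m).
    move=> Sm; apply: Lm; apply: card_le_trans Sm.
    apply: card_le_trans (card_image_le (fun i => graph_line (u i) (w i)) S).
    apply: subset_card_le => l Ll; have [i /= hi iE] := LA _ Ll.
    by exists i => //; split=> //; rewrite iE.
  have [|a [a' [aa' a'r exa exa']]] := exists_two_levels m0 nr _ Sm.
    by move=> i [].
  have [i [k [[hi Li] [hk Lk] fa]]] := exa.
  have [i' [k' [[hi' Li'] [hk' Lk'] fa']]] := exa'.
  have level i1 i2 c : (i1 < n)%N -> (i2 < n)%N -> (c < r)%N ->
      L (graph_line (u i1) (w i1)) -> L (graph_line (u i2) (w i2)) ->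
      first_differing m c i1 i2 ->
      exists p : plane R, [/\ C j p, `|p.1| <= W, `|p.2| <= H &
        `|p.2 - c%:R| <= 1 / 4%:R].
    move=> h1 h2 cr L1 L2 fc.
    have i12 : i1 <> i2 by move=> i12; apply: (proj1 fc); rewrite i12.
    have [p [Cp p1 p2]] := encloses_graph_lines uinj CL h1 h2 i12 L1 L2.
    have [pW pc] := levelA _ _ _ _ h1 h2 cr fc p1 p2.
    exists p; split=> //; rewrite /H.
    have c0 : 0 <= c%:R :> R by rewrite ler0n.
    have cr' : c%:R <= r%:R :> R by rewrite ler_nat ltnW.
    by move: pc; rewrite !ler_norml => /andP[? ?]; apply/andP; split; lra.
  have [p [Cp pW pH pa]] := level _ _ _ hi hk (ltn_trans aa' a'r) Li Lk fa.
  have [q [Cq qW qH qa']] := level _ _ _ hi' hk' a'r Li' Lk' fa'.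
  exists a; first by rewrite -ltnS prednK // (leq_trans _ a'r).
  have r0 : 0 <= r%:R :> R by rewrite ler0n.
  have aa1 : a%:R + 1 <= a'%:R :> R by rewrite natr1 ler_nat.
  move: pa qa'; rewrite !ler_norml => /andP[? ?] /andP[? ?].
  (* Here [p.2 <= a + 1 / 4] and [q.2 >= a' - 1 / 4 >= a + 3 / 4], the required margins around
     [a + 1 / 2]. *)
  apply: (convex_set_box (cC j) Cp Cq Cb _ pW qW pH qH _ bX); rewrite /H; lra.
have /choice[f boxC] : forall j, exists a : 'I_r.-1,
    [set s | W < s.1 < W + 1 /\ `|s.2 - (a%:R + 1 / 2%:R)| < 1 / 8%:R] `<=` C j.
  by move=> j; have [a ar boxa] := box j; exists (Ordinal ar).
(* There are [r] parts but only [r.-1] boxes. *)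
have [i [j [ij fij]]] : exists i j, i <> j /\ f i = f j.
  apply: contrapT => nex; have /leq_card : injective f.
    by move=> i j fij; apply: contrapT => ij; apply: nex; exists i, j.
  by rewrite !card_ord leqNgt ltn_predL hr.
(* The centre of the common box is interior to both parts. *)
apply/ij/(tC i j) => //; exists (W + 1 / 2%:R, (f i)%:R + 1 / 2%:R).
by split; apply: box_interior; [|rewrite fij]; exact: boxC.
Qed.
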